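(* Let $L\in(0,\infty)$ and let the saddle-gradient operator $F:\mathbb{R}^d\to\mathbb{R}^d$ be $L$-Lipschitz continuous and monotone. Let $\tilde Fz_{k/2}=Fz_{k/2}+\xi_{k/2}$, where $\{\xi_{k/2}\}_{k\ge0}$ are independent random variables satisfying $\mathbb{E}[\xi_{k/2}]=0$ and $\mathbb{E}[\|\xi_{k/2}\|^2]=\sigma_{k/2}^2$ for all $k\ge0$. Let $z_0\in\mathbb{R}^d$ and let $\{z_k\}_{k\ge0}$ be the sequence generated by the S-FEG method: for $k=0,1,2,\dots$ $$z_{k+1/2} = z_k + \tfrac{1}{k+1}(z_0-z_k) - \Big(1-\tfrac{1}{k+1}\Big)\tfrac{1}{L}\tilde Fz_k,\qquad z_{k+1} = z_k + \tfrac{1}{k+1}(z_0-z_k) - \tfrac{1}{L}\tilde Fz_{k+1/2}.$$ Then for any $z_*\in\mathbb{R}^d$ with $Fz_*=0$ and for all $k\ge1$, $$\mathbb{E}[\|Fz_k\|^2]\le \frac{4L^2\|z_0-z_*\|^2}{k^2} + \frac{6}{k^2}\left[\sigma_0^2 + \sum_{l=1}^{k-1}\left(l^2\sigma_l^2 + (l+1)^2\sigma_{l+1/2}^2\right)\right].$$ Furthermore, if, for a real number $\epsilon$, $\sigma_0^2\le\frac{\epsilon}{6}$, $\sigma_k^2\le\frac{\epsilon}{6k}$ and $\sigma_{k+1/2}^2\le\frac{\epsilon}{6(k+1)}$ for all $k\ge1$, then this bound reduces to $$\mathbb{E}[\|Fz_k\|^2]\le \frac{4L^2\|z_0-z_*\|^2}{k^2}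 + \epsilon$$ for all $k\ge1$.
   Context: Write $d=d_x+d_y$ and $z=(x,y)\in\mathbb{R}^{d_x}\times\mathbb{R}^{d_y}=\mathbb{R}^d$, with the Euclidean inner product and norm. For a smooth function $f:\mathbb{R}^{d_x}\times\mathbb{R}^{d_y}\to\mathbb{R}$, its saddle-gradient operator is $F=(\nabla_x f,-\nabla_y f)$; $Fz$ denotes $F(z)$. $F$ is $L$-Lipschitz continuous if $\|Fz-Fz'\|\le L\|z-z'\|$ for all $z,z'$, and monotone if $\langle Fz-Fz',z-z'\rangle\ge0$ for all $z,z'$. The iterates carry integer and half-integer indices, and $\tilde Fz_{k/2}$ (for integers $k\ge0$) denotes the noisy oracle output at the iterate $z_{k/2}$.
   Formalization: The formal theorem adds the assumption $\sigma_{1/2}^2\le\sigma_0^2$; without it the bound fails at $k=1$, e.g. $Fz=Lz$ on $\mathbb{R}$, $z_0=z_*=0$, $\sigma_0=0$, $\sigma_{1/2}=1$, since $z_{1/2}=z_0$ and $z_1$ depends on $\xi_{1/2}$ only. *)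

(* Defs.v *)
From HB Require Import structures.
From mathcomp Require Import all_boot all_order all_algebra.
From mathcomp Require Import all_classical all_reals all_analysis.

Set Implicit Arguments.
Unset Strict Implicit.
Unset Printing Implicit Defensive.

Import Order.TTheory GRing.Theory Num.Theory.
Import numFieldNormedType.Exports.

Local Open Scope classical_set_scope.
Local Open Scope ring_scope.

(* The library norm `|_| on 'rV[R]_n is the sup norm, hence the explicit
   Euclidean structure below. Both induce the same topology, the same
   derivatives and the same Borel sets. *)
Definition dotv (R : realType) (n : nat) (u v : 'rV[R]_n) : R :=
  \sum_(i < n) u 0 i * v 0 i.

Definition enorm (R : realType) (n : nat) (u : 'rV[R]_n) : R :=
  Num.sqrt (dotv u u).

Definition gradient (R : realType) (n : nat) (g : 'rV[R]_n -> R)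
    (u : 'rV[R]_n) : 'rV[R]_n :=
  \row_(i < n) 'D_(delta_mx 0 i) g u.

(* Points of R^dx * R^dy are identified with the row vectors row_mx x y. *)
Definition saddle_gradient (R : realType) (dx dy : nat)
    (f : 'rV[R]_dx -> 'rV[R]_dy -> R) (z : 'rV[R]_(dx + dy)) :
    'rV[R]_(dx + dy) :=
  row_mx (gradient (fun x => f x (rsubmx z)) (lsubmx z))
         (- gradient (fun y => f (lsubmx z) y) (rsubmx z)).

(* Only differentiability is required for f to be smooth: f is then C^1 as soon
   as its saddle-gradient operator is Lipschitz continuous. *)
Definition smooth (R : realType) (dx dy : nat)
    (f : 'rV[R]_dx -> 'rV[R]_dy -> R) : Prop :=
  forall p : 'rV[R]_dx * 'rV[R]_dy, differentiable (fun q => f q.1 q.2) p.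

Definition lipschitz_op (R : realType) (n : nat) (L : R)
    (F : 'rV[R]_n -> 'rV[R]_n) : Prop :=
  forall z z', enorm (F z - F z') <= L * enorm (z - z').

Definition monotone_op (R : realType) (n : nat)
    (F : 'rV[R]_n -> 'rV[R]_n) : Prop :=
  forall z z', 0 <= dotv (F z - F z') (z - z').

Definition borel (R : realType) (n : nat) : set (set 'rV[R]_n) :=
  <<s [set A : set 'rV[R]_n | open A] >>.

Definition random_vector (d : measure_display) (T : measurableType d)
    (R : realType) (n : nat) (X : T -> 'rV[R]_n) : Prop :=
  forall B, borel B -> measurable (X @^-1` B).

Definition independent_vectors (d : measure_display) (T : measurableType d)
    (R : realType) (P : probability T R) (n : nat)
    (X : nat -> T -> 'rV[R]_n) : Prop :=
  forall (J : seq nat) (B : nat -> set 'rV[R]_n),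
    uniq J -> (forall j, j \in J -> borel (B j)) ->
    P (\bigcap_(j in [set` J]) (X j @^-1` B j)) =
    (\prod_(j <- J) P (X j @^-1` B j))%E.

(* A half-integer index m/2 is encoded by m : nat, so that the integer index k
   is k.*2 and the half-integer index k + 1/2 is k.*2.+1.
   sfeg L z0 Ft z: the iterates z are produced by S-FEG from z0 with oracle
   outputs Ft, along every outcome w. *)
Definition sfeg (T : Type) (R : realType) (n : nat) (L : R) (z0 : 'rV[R]_n)
    (Ft z : nat -> T -> 'rV[R]_n) : Prop :=
  (forall w, z 0%N w = z0) /\
  forall (k : nat) (w : T),
    z k.*2.+1 w = z k.*2 w + (1 / k.+1%:R) *: (z0 - z k.*2 w)
                  - ((1 - 1 / k.+1%:R) * (1 / L)) *: Ft k.*2 w /\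
    z k.+1.*2 w = z k.*2 w + (1 / k.+1%:R) *: (z0 - z k.*2 w)
                  - (1 / L) *: Ft k.*2.+1 w.

(* Main.v *)
Require Import Defs.
From HB Require Import structures.
From mathcomp Require Import all_boot all_order all_algebra.
From mathcomp Require Import all_classical all_reals all_analysis.
From mathcomp Require Import measurable_realfun.
From mathcomp Require Import ring lra.
Import Order.TTheory GRing.Theory Num.Theory.
Import numFieldNormedType.Exports.
Local Open Scope classical_set_scope.
Local Open Scope ring_scope.

(** The potential Phi_k = k^2 |F z_k|^2 - 2 L k <F z_k, z_0 - z_k> increases
    along one step, pathwise, by at most
    3 ((k+1)^2 |xi_{k+1/2}|^2 + k^2 |xi_k|^2) plus cross terms <W, xi_{k+1/2}> +
    <V, xi_k>: replacing each iterate by the point that the method would reach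
    without its last noise term costs one further noise square, by the Lipschitz
    property, and makes W and V functions of the earlier noise alone. By
    independence the cross terms have mean zero. Monotonicity at z_* gives
    k^2 |F z_k|^2 <= 2 Phi_k + 4 L^2 |z_0 - z_*|^2, and Phi_0 = 0. *)

(** * Pathwise inequalities for the potential *)

Lemma dotv_ge0 {R : realType} {n : nat} (u : 'rV[R]_n) : 0 <= dotv u u.
Proof. by apply: sumr_ge0 => i _; rewrite -expr2 sqr_ge0. Qed.

Lemma enorm_sqr {R : realType} {n : nat} (u : 'rV[R]_n) :
  enorm u ^+ 2 = dotv u u.
Proof. by rewrite sqr_sqrtr// dotv_ge0. Qed.

Lemma lipschitz_op_sqr {R : realType} {n : nat} {L : R}
    {F : 'rV[R]_n -> 'rV[R]_n} (hLip : lipschitz_op L F) (z z' : 'rV[R]_n) :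
  dotv (F z - F z') (F z - F z') <= L ^+ 2 * dotv (z - z') (z - z').
Proof.
rewrite -!enorm_sqr -exprMn; have := hLip z z'.
by rewrite /lipschitz_op => h; rewrite lerXn2r// nnegrE ?sqrtr_ge0//;
  apply: le_trans h; rewrite sqrtr_ge0.
Qed.

Definition potential {R : realType} {n : nat} (L : R)
    (F : 'rV[R]_n -> 'rV[R]_n) (z0 : 'rV[R]_n) (k : nat) (z : 'rV[R]_n) : R :=
  k%:R ^+ 2 * dotv (F z) (F z) - 2 * L * k%:R * dotv (F z) (z0 - z).

(** The gap between the two sides is exactly a nonnegative combination of monotonicity at [z'], [z],
    three Lipschitz inequalities and two squares. Each noise square is counted three times: once
    when [z'] is compared with [zh], once when its noise-free point is compared with the true one,
    and once in the Young inequality that splits the resulting product. Hence the factor 3. *)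
Lemma potential_step {R : realType} {n : nat} {L : R}
    {F : 'rV[R]_n -> 'rV[R]_n} (z0 z xi eta : 'rV[R]_n) (k : nat) :
  0 < L -> lipschitz_op L F -> monotone_op F ->
  forall zb zh zb' z',
  zb = z + (1 / k.+1%:R) *: (z0 - z)
         - ((1 - 1 / k.+1%:R) * (1 / L)) *: F z ->
  zh = zb - ((1 - 1 / k.+1%:R) * (1 / L)) *: xi ->
  zb' = z + (1 / k.+1%:R) *: (z0 - z) - (1 / L) *: F zh ->
  z' = zb' - (1 / L) *: eta ->
  potential L F z0 k.+1 z' <= potential L F z0 k z
    + 3 * (k.+1%:R ^+ 2 * dotv eta eta + k%:R ^+ 2 * dotv xi xi)
    + (dotv ((2 * k.+1%:R ^+ 2) *: (F zh - F zb') - (2 * k.+1%:R * k%:R) *: xi)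
            eta
     + dotv ((2 * k%:R ^+ 2) *: F z - (2 * k.+1%:R * k%:R) *: F zb) xi).
Proof.
move=> L0 hLip hmon zb zh zb' z' zbE zhE zb'E z'E.
have M := hmon z' z.
have P1 := lipschitz_op_sqr hLip z' zh.
have P2 := lipschitz_op_sqr hLip z' zb'.
have P3 := lipschitz_op_sqr hLip zh zb.
(* [F z'] and [F zh] contain the noise they are paired with; these squares trade them for [F zb']
   and [F zb], which do not involve that last noise term. *)
have Q1 := dotv_ge0 (F z' - F zb' + eta).
have Q2 := dotv_ge0 (k%:R *: xi + k.+1%:R *: (F zh - F zb)).
rewrite -subr_ge0 in P1; rewrite -subr_ge0 in P2; rewrite -subr_ge0 in P3.
have n0 : 0 < k.+1%:R :> R by rewrite ltr0n.
have n2 : 0 <= k.+1%:R ^+ 2 :> R by rewrite sqr_ge0.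
have c0 : 0 <= 2 * L * k%:R * k.+1%:R :> R.
  by rewrite !mulr_ge0// ltW.
rewrite -subr_ge0.
have := addr_ge0 (mulr_ge0 c0 M) (addr_ge0 (mulr_ge0 n2 P1)
  (addr_ge0 (mulr_ge0 n2 P2) (addr_ge0 (mulr_ge0 n2 P3)
  (addr_ge0 (mulr_ge0 n2 Q1) Q2)))).
congr (_ <= _).
rewrite /potential /dotv !(mulr_sumr, =^~ big_split, =^~ sumrB) /=.
rewrite -?sumrN -?big_split/=.
apply: eq_bigr => i _.
(* The identity holds for arbitrary operator values, so they are generalized before the points are
   unfolded; what remains is a rational identity in one coordinate. *)
move: (F z') (F zb') (F zh) (F zb) zbE zhE zb'E z'E.
move=> Fz' Fzb' Fzh Fzb zbE zhE zb'E z'E.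
rewrite z'E zb'E zhE zbE.
rewrite !mxE.
have nk : k.+1%:R = k%:R + 1 :> R by rewrite natr1.
rewrite nk in n0 *.
have := lt0r_neq0 L0. have := lt0r_neq0 n0.
move: (k%:R : R) => K. move=> h1 h2.
field. by rewrite h1 h2.
Qed.

Lemma potential0 {R : realType} {n : nat} (L : R) (F : 'rV[R]_n -> 'rV[R]_n)
    (z0 z : 'rV[R]_n) : potential L F z0 0 z = 0.
Proof. by rewrite /potential expr0n/= !(mulr0, mul0r) subr0. Qed.

(** Splitting [z0 - z] at [zs], the gap is [4 * L * k] times the nonnegative product of [F z] and
    [z - zs], plus the completed square of [k F z - 2 L (z0 - zs)]. *)
Lemma sqr_le_potential {R : realType} {n : nat} {L : R}
    {F : 'rV[R]_n -> 'rV[R]_n} (z0 z zs : 'rV[R]_n) (k : nat) :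
  0 < L -> monotone_op F -> F zs = 0 ->
  k%:R ^+ 2 * dotv (F z) (F z) <=
    2 * potential L F z0 k z + 4 * L ^+ 2 * dotv (z0 - zs) (z0 - zs).
Proof.
move=> L0 hmon Fzs.
have M := hmon z zs; rewrite Fzs subr0 in M.
have Q := dotv_ge0 (k%:R *: F z - (2 * L) *: (z0 - zs)).
have c0 : 0 <= 4 * L * k%:R :> R by rewrite !mulr_ge0// ltW.
rewrite -subr_ge0; have := addr_ge0 (mulr_ge0 c0 M) Q; congr (_ <= _).
rewrite /potential /dotv !(mulr_sumr, =^~ big_split, =^~ sumrB) /=.
by apply: eq_bigr => i _; rewrite !mxE; ring.
Qed.

(** * Products with an independent centred factor have mean zero *)

Lemma measurable_sub_sigma {disp : measure_display} {T : measurableType disp}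
    {d' : measure_display} {T' : measurableType d'} {G : set (set T)}
    {W : T -> T'} :
  G `<=` measurable ->
  measurable_fun [set: g_sigma_algebraType G] W -> measurable_fun [set: T] W.
Proof.
move=> Gm mW _ B mB.
have := mW measurableT B mB.
exact: (smallest_sub (@sigma_algebra_measurable _ T) Gm).
Qed.

Section zero_mean_product.
Context {disp : measure_display} {T : measurableType disp} {R : realType}.
Context {P : probability T R} {G : set (set T)} {X : T -> R}.
Hypotheses (Gm : G `<=` measurable) (GI : setI_closed G) (GT : G setT).
Hypothesis (mX : measurable_fun [set: T] X).
Hypothesis GX : forall A B, G A -> measurable B ->
  P (A `&` X @^-1` B) = (P A * P (X @^-1` B))%E.

(** Dynkin's uniqueness argument: for fixed [B], both sides are finite measures in [A] that agree on
    the pi-system [G], hence on the sigma-algebra it generates. *)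
Lemma indep_sigma (A : set T) (B : set R) : <<s G >> A -> measurable B ->
  P (A `&` X @^-1` B) = (P A * P (X @^-1` B))%E.
Proof.
move=> GA mB.
have mXB : measurable (X @^-1` B) by rewrite -[X @^-1` B]setTI; exact: mX.
have PXB : P (X @^-1` B) \is a fin_num by exact: fin_num_measure.
pose c := NngNum (fine_ge0 (measure_ge0 P (X @^-1` B))).
suff : mrestr P mXB A = mscale c P A by rewrite /mscale /= fineK// muleC.
apply: (g_sigma_algebra_measure_unique G Gm (fun=> setT)) GA => //.
- by rewrite bigcup_const//; exists 0%N.
- move=> C GC.
  change (P (C `&` X @^-1` B) = (fine (P (X @^-1` B)))%:E * P C)%E.
  by rewrite GX// fineK// muleC.
- move=> _; change (P (setT `&` X @^-1` B) < +oo)%E.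
  by rewrite setTI ltey_eq PXB.
Qed.

(** Independence makes the joint law of [W] and [X] the product of their laws. Fubini then
    integrates [X] out first, and the inner integral is a value of [W] times the mean of [X], that
    is 0. *)
Lemma expectation_mul_indep0 (W : T -> R) :
  measurable_fun [set: g_sigma_algebraType G] W ->
  P.-integrable setT (EFin \o X) ->
  P.-integrable setT (EFin \o (W \* X)) ->
  ('E_P[X] = 0)%E -> ('E_P[W \* X] = 0)%E.
Proof.
move=> mW iX iWX; rewrite unlock => EX.
have mW' := measurable_sub_sigma Gm mW.
pose W' : {RV P >-> R} := mfun_Sub (mem_set mW').
pose X' : {RV P >-> R} := mfun_Sub (mem_set mX).
have mWX : measurable_fun setT (fun w => (W w, X w)).
  exact: measurable_fun_pair.
pose J : {RV P >-> (R * R)%type} := mfun_Sub (mem_set mWX).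
pose mu := distribution P W'; pose nu := distribution P X'.
have lawE : forall A, measurable A -> (mu \x nu)%E A = distribution P J A.
  apply: product_measure_unique => A B mA mB /=.
  apply: indep_sigma => //.
  by have := mW measurableT A mA; rewrite setTI.
pose g (p : R * R) : \bar R := (p.1 * p.2)%:E.
have mg : measurable_fun [set: (R * R)%type] g.
  by apply/measurable_EFinP; apply: measurable_funM.
have igJ : (distribution P J).-integrable setT g.
  by apply: integrable_pushforward.
have intE (h : R * R -> \bar R) :
    (\int[(mu \x nu)%E]_p h p = \int[distribution P J]_p h p)%E.
  by apply: eq_measure_integral => A mA _; exact: lawE.
have igM : (mu \x nu)%E.-integrable setT g.
  by apply/integrableP; split; [|move/integrableP : igJ => [_]; rewrite -intE].
transitivity (\int[distribution P J]_p g p)%E.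
  by rewrite integral_distribution.
rewrite -intE -integral12_prod_meas1// integral0_eq// => x _.
rewrite /fubini_F /g /=.
under eq_integral do rewrite EFinM.
have iX' : nu.-integrable setT (EFin \o id).
  apply: integrable_pushforward => //.
  apply/measurable_EFinP. exact: measurable_id.
rewrite integralZl//.
rewrite (_ : \int[nu]_x x%:E = 0)%E ?mule0//.
by rewrite integral_distribution.
Qed.

End zero_mean_product.

(** * Measurability of vector-valued maps and of their Lipschitz images *)

Lemma measurable_fun_open {R : realType} {d : measure_display}
    {T : measurableType d} (f : T -> R) :
  (forall A : set R, open A -> measurable (f @^-1` A)) ->
  measurable_fun [set: T] f.
Proof.
move=> fo; apply: (measurability _ (RGenOpens.measurableE R)).
move=> _ [_ [a [b ->] <-]]; rewrite setTI.
exact/fo/interval_open.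
Qed.

(* An open set is the union of the balls of radius 1/(k+1) with rational
   centres that it contains, and a ball of the sup norm is a box. *)
Lemma measurable_preimage_open {R : realType} {d : measure_display}
    {T : measurableType d} {n : nat} (V : T -> 'rV[R]_n) :
  (forall i, measurable_fun [set: T] (fun w => V w 0 i)) ->
  forall A : set 'rV[R]_n, open A -> measurable (V @^-1` A).
Proof.
move=> mV A oA.
pose D := [set p : 'rV[rat]_n * nat |
  ball (map_mx (@ratr R) p.1 : 'rV[R]_n) p.2.+1%:R^-1 `<=` A].
pose B (p : 'rV[rat]_n * nat) : set T := [set w | D p /\
  forall i, `|ratr (p.1 0 i) - V w 0 i| < p.2.+1%:R^-1].
rewrite (_ : V @^-1` A = \bigcup_p B p).
  apply: countable_bigcupT_measurable => // -[c k].
  have [DB|nD] := pselect (D (c, k)); last first.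
    rewrite (_ : B _ = set0)//; apply/seteqP; split => // w [/= ].
    by move=> /nD.
  rewrite (_ : B _ = \bigcap_(i in [set: 'I_n])
     [set w | `|ratr (c 0 i) - V w 0 i| < k.+1%:R^-1]); last first.
    apply/seteqP; split => w.
      by move=> [_ h] i _; exact: h.
    by move=> h; split => // i; exact: h.
  apply: fin_bigcap_measurable => // i _.
  have /(_ measurableT [set true]) : measurable_fun [set: T]
      (fun w => `|ratr (c 0 i) - V w 0 i| < k.+1%:R^-1).
    apply: measurable_fun_ltr => //.
    by apply: measurableT_comp => //; exact: measurable_funB.
  by rewrite setTI; exact.
apply/seteqP; split => [w /= AV|w [p _ [Dp h]]]; last first.
  apply: Dp; split; first by rewrite invr_gt0.
  by move=> i j; rewrite !ord1 !mxE; exact: h.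
have /nbhs_ballP[e /= e0 eA] : nbhs (V w) A by exact: open_nbhs_nbhs.
(* A ball of radius [1/(k+1)] whose centre is within [1/(k+1)] of [V w] stays within [e] of [V w],
   hence inside [A]. *)
have [k ke] : exists k : nat, k.+1%:R^-1 < e / 2.
  have [k _ h] := near_infty_natSinv_lt (PosNum (divr_gt0 e0 (ltr0Sn R 1))).
  by exists k; exact: h (leqnn k).
have k0 : 0 < k.+1%:R^-1 :> R by rewrite invr_gt0.
have /choice[c cV] : forall i, exists q : rat,
    `|ratr q - V w 0 i| < k.+1%:R^-1.
  move=> i.
  have /rat_in_itvoo[q] : V w 0 i - k.+1%:R^-1 < V w 0 i + k.+1%:R^-1.
    by rewrite ltrBlDr -addrA ltrDl addr_gt0.
  by rewrite in_itv/= => /andP[h1 h2]; exists q; rewrite ltr_distl h1 h2.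
exists (\row_i c i, k) => //; split => [u [_ cu]|i]; last by rewrite mxE.
apply: eA; split => // a i; rewrite !ord1.
have := cu 0 i; rewrite !mxE /ball/= => h.
rewrite (splitr e) -(subrKA (ratr (c i))) (le_lt_trans (ler_normD _ _))//.
by rewrite ltrD// (lt_trans _ ke)// distrC.
Qed.

Lemma coord_le_enorm {R : realType} {n : nat} (u : 'rV[R]_n) i :
  `|u 0 i| <= enorm u.
Proof.
rewrite -(ler_pXn2r (ltn0Sn 1)) ?nnegrE ?sqrtr_ge0// enorm_sqr.
rewrite real_normK ?num_real// /dotv (bigD1 i)//= -expr2 lerDl.
by apply: sumr_ge0 => j _; rewrite -expr2 sqr_ge0.
Qed.

(** The crude factor [n.+1] stays positive in dimension 0, so that the continuity proof below can
    divide by it. *)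
Lemma enorm_le_coord {R : realType} {n : nat} (u : 'rV[R]_n) (r : R) :
  0 <= r -> (forall i, `|u 0 i| <= r) -> enorm u <= n.+1%:R * r.
Proof.
move=> r0 ur.
rewrite -(ler_pXn2r (ltn0Sn 1)) ?nnegrE ?sqrtr_ge0 ?mulr_ge0// enorm_sqr exprMn.
have ui i : u 0 i * u 0 i <= r ^+ 2.
  by rewrite -expr2 -[leLHS]real_normK ?num_real// lerXn2r ?nnegrE.
rewrite /dotv (le_trans (ler_sum _ (fun i _ => ui i)))// sumr_const card_ord.
rewrite -[leLHS]mulr_natl; apply: ler_wpM2r; first exact: sqr_ge0.
rewrite -natrX ler_nat.
by rewrite (leq_trans (leqnSn n))// leq_pmulr.
Qed.

Lemma lipschitz_op_coord_continuous {R : realType} {n : nat} {L : R}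
    {F : 'rV[R]_n -> 'rV[R]_n} :
  0 < L -> lipschitz_op L F -> forall i, continuous (fun z => F z 0 i).
Proof.
move=> L0 hLip i z A /nbhs_ballP[e /= e0 eA].
have c0 : 0 < L * n.+1%:R by rewrite mulr_gt0.
(* The factor [n.+1] converts the sup-norm ball into a Euclidean bound; halving [e] makes the final
   inequality strict. *)
have d0 : 0 < e / 2 / (L * n.+1%:R) by rewrite !divr_gt0.
apply/nbhs_ballP; exists (e / 2 / (L * n.+1%:R)) => //= y [_ zy]; apply: eA.
apply: le_lt_trans (_ : e / 2 < e); last first.
  by rewrite ltr_pdivrMr// ltr_pMr// ltr1n.
have := coord_le_enorm (F z - F y) i; rewrite !mxE => /le_trans; apply.
rewrite (le_trans (hLip _ _))// -[leRHS](divfK (lt0r_neq0 c0)) [leRHS]mulrC.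
rewrite -mulrA; apply: ler_wpM2l; first exact: ltW.
by apply: enorm_le_coord; [exact: ltW|move=> j; rewrite !mxE ltW//; exact: zy].
Qed.

(** The measurable space is arbitrary, so this applies also when [T] carries a smaller
    sigma-algebra, such as that of the earlier noise. *)
Lemma measurable_lipschitz_op {R : realType} {d : measure_display}
    {T : measurableType d} {n : nat} {L : R}
    {F : 'rV[R]_n -> 'rV[R]_n} (V : T -> 'rV[R]_n) :
  0 < L -> lipschitz_op L F ->
  (forall i, measurable_fun [set: T] (fun w => V w 0 i)) ->
  forall i, measurable_fun [set: T] (fun w => F (V w) 0 i).
Proof.
move=> L0 hLip mV i; apply: measurable_fun_open => A oA.
apply: (measurable_preimage_open V mV ((fun z => F z 0 i) @^-1` A)).
have /continuousP := lipschitz_op_coord_continuous L0 hLip i; exact.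
Qed.

(** A pi-system generating the sigma-algebra of [xi 0, ..., xi (m - 1)]. The index [m] itself is
    excluded, which leaves [xi m] independent of it. *)
Definition past {T : Type} {R : realType} {n : nat} (xi : nat -> T -> 'rV[R]_n)
    (m : nat) : set (set T) :=
  [set A | exists2 B : nat -> set 'rV[R]_n, (forall j, borel (B j)) &
     A = \bigcap_(j in [set j | (j < m)%N]) (xi j @^-1` B j)].

(** * Square-integrable functions measurable for a sub-sigma-algebra *)

Section square_integrable.
Context {disp : measure_display} {T : measurableType disp} {R : realType}.
Context {P : probability T R}.

(** With [G := past xi m] this says that [W] is an L^2 function of the noise before [m]. *)
Definition square_integrable_wrt (G : set (set T)) (W : T -> R) : Prop :=
  measurable_fun [set: g_sigma_algebraType G] W /\
  P.-integrable setT (fun w => (W w ^+ 2)%:E).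

Definition square_integrable_vector (G : set (set T)) {n : nat}
    (V : T -> 'rV[R]_n) : Prop :=
  forall i, square_integrable_wrt G (fun w => V w 0 i).

Lemma integrable_bounded {h f g : T -> R} :
  measurable_fun [set: T] h ->
  P.-integrable setT (EFin \o f) -> P.-integrable setT (EFin \o g) ->
  (forall w, `|h w| <= f w + g w) -> P.-integrable setT (EFin \o h).
Proof.
move=> mh fi gi hfg.
apply: le_integrable (integrableD measurableT fi gi) => //.
  exact/measurable_EFinP.
move=> w _; rewrite -EFinD !abse_EFin lee_fin.
exact: le_trans (hfg w) (ler_norm _).
Qed.

Lemma integrable_scale (a : R) {f : T -> R} :
  P.-integrable setT (EFin \o f) ->
  P.-integrable setT (EFin \o (fun w => a * f w)).
Proof.
move=> fi; have := integrableZl measurableT a fi.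
by apply: eq_integrable => // w _; rewrite /= EFinM.
Qed.

Lemma integrable_add {f g : T -> R} :
  P.-integrable setT (EFin \o f) -> P.-integrable setT (EFin \o g) ->
  P.-integrable setT (EFin \o (fun w => f w + g w)).
Proof.
move=> fi gi; have := integrableD measurableT fi gi.
by apply: eq_integrable => // w _; rewrite /= EFinD.
Qed.

Lemma integrable_sum_real {n : nat} {f : 'I_n -> T -> R} :
  (forall i, P.-integrable setT (EFin \o f i)) ->
  P.-integrable setT (EFin \o (fun w => \sum_(i < n) f i w)).
Proof.
move=> fi; have := integrable_sum measurableT (index_enum 'I_n)
  (fun i (_ : xpredT i) => fi i).
by apply: eq_integrable => // w _; rewrite /= -sumEFin.
Qed.

Section filtration.
Context {G : set (set T)} (Gm : G `<=` measurable).

(** The product is dominated by [V^2 + W^2]. *)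
Lemma square_integrable_mul {V W : T -> R} :
  measurable_fun [set: T] V -> measurable_fun [set: T] W ->
  P.-integrable setT (fun w => (V w ^+ 2)%:E) ->
  P.-integrable setT (fun w => (W w ^+ 2)%:E) ->
  P.-integrable setT (EFin \o (V \* W)).
Proof.
move=> mV mW iV iW; apply: (integrable_bounded _ iV iW).
  exact: measurable_funM.
move=> w /=; rewrite normrM -[V w ^+ 2]real_normK ?num_real//.
rewrite -[W w ^+ 2]real_normK ?num_real//.
have := normr_ge0 (V w); have := normr_ge0 (W w).
move: `|V w| `|W w| => a b; have := sqr_ge0 (a - b); nra.
Qed.

Lemma square_integrable_cst (c : R) : square_integrable_wrt G (fun=> c).
Proof.
split; first exact: measurable_cst.
exact: finite_measure_integrable_cst.
Qed.

Lemma square_integrableZ (a : R) {W : T -> R} :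
  square_integrable_wrt G W -> square_integrable_wrt G (fun w => a * W w).
Proof.
move=> [mW iW]; split; first exact: measurable_funM.
have := integrable_scale (a ^+ 2) iW.
by apply: eq_integrable => // w _; rewrite /= exprMn.
Qed.

Lemma square_integrableD {V W : T -> R} :
  square_integrable_wrt G V -> square_integrable_wrt G W ->
  square_integrable_wrt G (fun w => V w + W w).
Proof.
move=> [mV iV] [mW iW].
have mVW : measurable_fun [set: g_sigma_algebraType G] (fun w => V w + W w).
  exact: measurable_funD.
split => //.
apply: (integrable_bounded _ (integrable_scale 2 iV) (integrable_scale 2 iW)).
  by apply: measurable_funX; exact: measurable_sub_sigma Gm mVW.
move=> w; rewrite ger0_norm ?sqr_ge0//.
by have := sqr_ge0 (V w - W w); nra.
Qed.

Lemma square_integrable_vectorZ (a : R) {n : nat} {V : T -> 'rV[R]_n} :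
  square_integrable_vector G V ->
  square_integrable_vector G (fun w => a *: V w).
Proof.
move=> hV i; have := square_integrableZ a (hV i).
by congr (square_integrable_wrt G _); apply/funext => w; rewrite mxE.
Qed.

Lemma square_integrable_vectorD {n : nat} {V W : T -> 'rV[R]_n} :
  square_integrable_vector G V -> square_integrable_vector G W ->
  square_integrable_vector G (fun w => V w + W w).
Proof.
move=> hV hW i; have := square_integrableD (hV i) (hW i).
by congr (square_integrable_wrt G _); apply/funext => w; rewrite mxE.
Qed.

Lemma square_integrable_vectorB {n : nat} {V W : T -> 'rV[R]_n} :
  square_integrable_vector G V -> square_integrable_vector G W ->
  square_integrable_vector G (fun w => V w - W w).
Proof.
move=> hV hW.
have := square_integrable_vectorD hV (square_integrable_vectorZ (-1) hW).
by congr (square_integrable_vector G _); apply/funext => w; rewrite scaleN1r.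
Qed.

Lemma square_integrable_vector_cst {n : nat} (v : 'rV[R]_n) :
  square_integrable_vector G (fun=> v).
Proof. by move=> i; exact: square_integrable_cst. Qed.

Lemma square_integrable_vector_measurable {n : nat} {V : T -> 'rV[R]_n} :
  square_integrable_vector G V ->
  forall i, measurable_fun [set: T] (fun w => V w 0 i).
Proof. by move=> hV i; exact: measurable_sub_sigma Gm (hV i).1. Qed.

Lemma square_integrable_vector_dotv {n : nat} {V W : T -> 'rV[R]_n} :
  square_integrable_vector G V -> square_integrable_vector G W ->
  P.-integrable setT (EFin \o (fun w => dotv (V w) (W w))).
Proof.
move=> hV hW; apply: integrable_sum_real => i.
apply: square_integrable_mul.
- exact: square_integrable_vector_measurable.
- exact: square_integrable_vector_measurable.
- exact: (hV i).2.
- exact: (hW i).2.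
Qed.

(** A Lipschitz operator grows at most linearly: each squared coordinate of [F (V w)] is at most
    [2 L^2 |V w|^2] plus twice that of [F 0]. *)
Lemma square_integrable_vector_op {n : nat} {L : R} {F : 'rV[R]_n -> 'rV[R]_n}
    {V : T -> 'rV[R]_n} : 0 < L -> lipschitz_op L F ->
  square_integrable_vector G V -> square_integrable_vector G (fun w => F (V w)).
Proof.
move=> L0 hLip hV i.
have mFV : measurable_fun [set: g_sigma_algebraType G] (fun w => F (V w) 0 i).
  by apply: (measurable_lipschitz_op _ L0 hLip) => j; exact: (hV j).1.
split => //.
have iV := square_integrable_vector_dotv hV hV.
have ic : P.-integrable setT (EFin \o (fun=> 2 * F 0 0 i ^+ 2)).
  exact: finite_measure_integrable_cst.
apply: (integrable_bounded _ (integrable_scale (2 * L ^+ 2) iV) ic).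
  by apply: measurable_funX; exact: measurable_sub_sigma Gm mFV.
move=> w /=; rewrite ger0_norm ?sqr_ge0//.
have := lipschitz_op_sqr hLip (V w) 0; rewrite subr0 => h.
have : (F (V w) 0 i - F 0 0 i) ^+ 2 <= L ^+ 2 * dotv (V w) (V w).
  apply: le_trans h; rewrite /dotv (bigD1 i)//= !mxE -expr2 lerDl.
  by apply: sumr_ge0 => j _; rewrite -expr2 sqr_ge0.
move: (dotv _ _) (F _ _ i) (F 0 0 i) => d a b.
(* Indeed [2 (a - b)^2 + 2 b^2 - a^2 = (a - 2 b)^2]. *)
by have := sqr_ge0 (a - 2 * b); nra.
Qed.
End filtration.

Lemma square_integrable_vector_sub {G G' : set (set T)} {n : nat}
    {V : T -> 'rV[R]_n} : G `<=` <<s G' >> ->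
  square_integrable_vector G V -> square_integrable_vector G' V.
Proof.
move=> GG' hV i; split; last exact: (hV i).2.
exact: (@measurable_sub_sigma _ (g_sigma_algebraType G') _ _ _ _ GG' (hV i).1).
Qed.
End square_integrable.
Arguments square_integrable_vector {disp T R} P G {n} V.

(** * The past of the noise and the vanishing of cross terms *)

Lemma borel_setT {R : realType} {n : nat} : borel ([set: 'rV[R]_n]).
Proof.
exact: (@measurableT _ (g_sigma_algebraType [set A : set 'rV[R]_n | open A])).
Qed.

Lemma borel_setI {R : realType} {n : nat} (A B : set 'rV[R]_n) :
  borel A -> borel B -> borel (A `&` B).
Proof.
exact: (@measurableI _ (g_sigma_algebraType [set A : set 'rV[R]_n | open A])).
Qed.

Lemma borel_coord {R : realType} {n : nat} (i : 'I_n) (C : set R) :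
  measurable C -> borel ((fun v : 'rV[R]_n => v 0 i) @^-1` C).
Proof.
move=> mC; pose B := g_sigma_algebraType [set A : set 'rV[R]_n | open A].
have : measurable_fun [set: B] (fun v : B => v 0 i).
  apply: measurable_fun_open => A oA; apply: sub_sigma_algebra => /=.
  by have /continuousP := @coord_continuous R 1 n 0 i; exact.
by move=> /(_ measurableT C mC); rewrite setTI.
Qed.

Section past_noise.
Context {disp : measure_display} {T : measurableType disp} {R : realType}.
Context {P : probability T R} {n : nat} {xi : nat -> T -> 'rV[R]_n}.
Hypothesis hxi : forall m, random_vector (xi m).

Lemma random_vector_coord (m : nat) (i : 'I_n) :
  measurable_fun [set: T] (fun w => xi m w 0 i).
Proof.
move=> _ C mC; rewrite setTI.
exact: (hxi m _ (borel_coord i C mC)).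
Qed.

Lemma past_measurable (m : nat) : past xi m `<=` measurable.
Proof.
move=> _ [B hB ->]; apply: fin_bigcap_measurable => // j _.
exact: (hxi j _ (hB j)).
Qed.

Lemma past_setT (m : nat) : past xi m setT.
Proof.
exists (fun=> setT); first by move=> _; exact: borel_setT.
by apply/seteqP; split.
Qed.

Lemma past_setI (m : nat) : setI_closed (past xi m).
Proof.
move=> _ _ [B hB ->] [C hC ->].
exists (fun j => B j `&` C j); first by move=> j; exact: borel_setI.
rewrite -bigcapI; apply: eq_bigcapr => j _; by rewrite preimage_setI.
Qed.

Lemma past_succ (m : nat) : past xi m `<=` past xi m.+1.
Proof.
move=> _ [B hB ->]; exists (fun j => if j == m then setT else B j).
  by move=> j; case: ifP => // _; exact: borel_setT.
apply/seteqP; split => w /= h j /= jm; last first.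
  by have := h j (ltnW jm); rewrite ltn_eqF.
case: eqP => // /eqP jm'; apply: (h j).
by rewrite /= ltn_neqAle jm' -ltnS.
Qed.

Lemma square_integrable_vector_past_succ {m : nat} {V : T -> 'rV[R]_n} :
  square_integrable_vector P (past xi m) V ->
  square_integrable_vector P (past xi m.+1) V.
Proof.
apply: square_integrable_vector_sub => A /past_succ.
exact: sub_sigma_algebra.
Qed.

Lemma square_integrable_vector_noise (m : nat) :
  ('E_P[fun w => (enorm (xi m w) ^+ 2)%R] < +oo)%E ->
  square_integrable_vector P (past xi m.+1) (xi m).
Proof.
rewrite unlock => fin i; split.
  move=> _ C mC; rewrite setTI; apply: sub_sigma_algebra.
  exists (fun j =>
    if j == m then (fun v : 'rV[R]_n => v 0 i) @^-1` C else setT).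
    by move=> j; case: ifP => _; [exact: borel_coord|exact: borel_setT].
  apply/seteqP; split => w /= h.
    by move=> j _; rewrite /preimage/=; case: eqP => // ->.
  by have := h m (ltnSn m); rewrite /preimage/= eqxx.
have mE : measurable_fun [set: T] (fun w => enorm (xi m w) ^+ 2).
  rewrite (_ : (fun _ => _) = (fun w => \sum_(i < n) xi m w 0 i ^+ 2)).
    apply: measurable_sum => j.
    by apply: measurable_funX; exact: random_vector_coord.
  by apply/funext => w; rewrite enorm_sqr; apply: eq_bigr => j _; rewrite expr2.
have iE : P.-integrable setT (fun w => (enorm (xi m w) ^+ 2)%:E).
  apply/integrableP; split; first exact/measurable_EFinP.
  by under eq_integral do rewrite abse_EFin ger0_norm ?sqr_ge0//.
apply: le_integrable iE => //.
  by apply/measurable_EFinP; apply: measurable_funX; exact: random_vector_coord.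
move=> w _; rewrite !abse_EFin lee_fin !ger0_norm ?sqr_ge0//.
rewrite -[leLHS]real_normK ?num_real// lerXn2r ?nnegrE ?sqrtr_ge0//.
exact: coord_le_enorm.
Qed.

Hypothesis hind : independent_vectors P xi.

(** An event of the past constrains [xi 0, ..., xi (m - 1)]. Adding a constraint on [xi m] gives an
    event of the same shape with one more index, and the product formula for independent vectors
    splits off its last factor. *)
Lemma past_indep (m : nat) (i : 'I_n) (A : set T) (C : set R) :
  past xi m A -> measurable C ->
  P (A `&` (fun w => xi m w 0 i) @^-1` C) =
  (P A * P ((fun w => xi m w 0%R i) @^-1` C))%E.
Proof.
move=> [B hB ->] mC.
pose C' := (fun v : 'rV[R]_n => v 0 i) @^-1` C.
pose B' j := if j == m then C' else B j.
have hB' j : borel (B' j).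
  by rewrite /B'; case: ifP => // _; exact: borel_coord.
have B'm : B' m = C' by rewrite /B' eqxx.
have B'E j : (j < m)%N -> B' j = B j by rewrite /B' => /ltn_eqF ->.
have past_prod k (D : nat -> set 'rV[R]_n) : (forall j, borel (D j)) ->
    P (\bigcap_(j in [set j | (j < k)%N]) (xi j @^-1` D j)) =
    (\prod_(j <- iota 0 k) P (xi j @^-1` D j))%E.
  move=> hD; rewrite -hind ?iota_uniq//; congr (P (\bigcap_(j in _) _)).
  by apply/seteqP; split => j /=; rewrite mem_iota add0n.
rewrite past_prod//.
transitivity (\prod_(j <- iota 0 m.+1) P (xi j @^-1` B' j))%E; last first.
  rewrite -addn1 iotaD add0n big_cat/= big_seq1 B'm.
  congr (_ * _)%E; apply: eq_big_seq => j.
  by rewrite mem_iota add0n => /B'E ->.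
rewrite -past_prod//; congr (P _); apply/seteqP; split => w /=.
  move=> [h hm] j /=; rewrite ltnS leq_eqVlt => /orP[/eqP->|jm].
    by rewrite /preimage/= B'm.
  by rewrite /preimage/= B'E//; exact: h.
move=> h; split; last by have := h m (ltnSn m); rewrite B'm.
by move=> j /= jm; have := h j (ltnW jm); rewrite /preimage/= B'E.
Qed.

Hypothesis hmean : forall m i, ('E_P[fun w => (xi m w 0 i)%R] = 0)%E.
Hypothesis hfin : forall m, ('E_P[fun w => (enorm (xi m w) ^+ 2)%R] < +oo)%E.

Lemma integrable_dotv_noise {m : nat} {W : T -> 'rV[R]_n} :
  square_integrable_vector P (past xi m) W ->
  P.-integrable setT (EFin \o (fun w => dotv (W w) (xi m w))).
Proof.
move=> hW; apply: (square_integrable_vector_dotv (past_measurable m.+1)).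
  exact: square_integrable_vector_past_succ.
exact: square_integrable_vector_noise.
Qed.

(** Coordinate by coordinate, [W] depends on the earlier noise only, while [xi m] is centred and
    independent of that noise. *)
Lemma expectation_dotv_noise {m : nat} {W : T -> 'rV[R]_n} :
  square_integrable_vector P (past xi m) W ->
  \int[P]_w dotv (W w) (xi m w) = 0.
Proof.
move=> hW; have hxm := square_integrable_vector_noise m (hfin m).
have iWx i : P.-integrable setT (EFin \o (fun w => W w 0 i * xi m w 0 i)).
  apply: square_integrable_mul.
  - exact: measurable_sub_sigma (past_measurable m) (hW i).1.
  - exact: random_vector_coord.
  - exact: (hW i).2.
  - exact: (hxm i).2.
have EWx i : (\int[P]_w (W w 0 i * xi m w 0 i)%:E = 0)%E.
  suff : ('E_P[(fun w => W w 0%R i) \* (fun w => xi m w 0%R i)] = 0)%E.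
    by rewrite unlock.
  apply: (expectation_mul_indep0 (past_measurable m) (@past_setI m)
    (past_setT m) (random_vector_coord m i) _ _ (hW i).1); last exact: hmean.
  - by move=> A B; exact: past_indep.
  (* Integrability of the noise coordinate follows from its second moment, by pairing it with the
     constant 1. *)
  - have i1 := square_integrable_cst (P := P) (G := past xi m) 1.
    have := square_integrable_mul (random_vector_coord m i)
       (measurable_sub_sigma (past_measurable m) i1.1) (hxm i).2 i1.2.
    by apply: eq_integrable => // w _ /=; rewrite mulr1.
  - exact: iWx.
transitivity (fine (\int[P]_w (\sum_(i < n) (W w 0%R i * xi m w 0%R i)%:E))%E).
  by congr fine; apply: eq_integral => w _; rewrite sumEFin.
rewrite integral_sum// big1// => i _; exact: EWx.
Qed.
End past_noise.

(** * Adaptedness of the iterates and descent of the potential in expectation *)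

Section sfeg_iterates.
Context {disp : measure_display} {T : measurableType disp} {R : realType}.
Context {P : probability T R} {n : nat}.
Context {F : 'rV[R]_n -> 'rV[R]_n} {L : R}.
Hypotheses (hL : 0 < L) (hLip : lipschitz_op L F) (hmon : monotone_op F).
Context {xi : nat -> T -> 'rV[R]_n} {sigma : nat -> R}.
Hypothesis hxi : forall m, random_vector (xi m).
Hypothesis hind : independent_vectors P xi.
Hypothesis hmean : forall m i, ('E_P[fun w => (xi m w 0 i)%R] = 0)%E.
Hypothesis hvar : forall m,
  ('E_P[fun w => (enorm (xi m w) ^+ 2)%R] = (sigma m ^+ 2)%R%:E)%E.
Context {z0 : 'rV[R]_n} {z Ft : nat -> T -> 'rV[R]_n}.
Hypothesis hFt : forall m w, Ft m w = F (z m w) + xi m w.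
Hypothesis hz : sfeg L z0 Ft z.

Lemma noise_fin m : ('E_P[fun w => (enorm (xi m w) ^+ 2)%R] < +oo)%E.
Proof. by rewrite hvar ltry. Qed.

Lemma noise_square_integrable m :
  square_integrable_vector P (past xi m.+1) (xi m).
Proof. exact: square_integrable_vector_noise hxi m (noise_fin m). Qed.

Lemma expectation_noise_sqr m :
  \int[P]_w dotv (xi m w) (xi m w) = sigma m ^+ 2.
Proof.
have := hvar m; rewrite unlock /Rintegral => h.
rewrite -[RHS]/(fine (sigma m ^+ 2)%:E) -h; congr fine.
by apply: eq_integral => w _; rewrite enorm_sqr.
Qed.

Lemma square_integrable_prediction {m : nat} {V N : T -> 'rV[R]_n} (a b : R) :
  square_integrable_vector P (past xi m) V ->
  square_integrable_vector P (past xi m) N ->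
  square_integrable_vector P (past xi m)
    (fun w => V w + a *: (z0 - V w) - b *: N w).
Proof.
move=> hV hN; have pm := past_measurable hxi m.
apply: square_integrable_vectorB => //; last exact: square_integrable_vectorZ.
apply: square_integrable_vectorD => //; apply: square_integrable_vectorZ => //.
apply: square_integrable_vectorB => //.
exact: square_integrable_vector_cst.
Qed.

Lemma square_integrable_oracle {m : nat} :
  square_integrable_vector P (past xi m) (z m) ->
  square_integrable_vector P (past xi m.+1) (Ft m).
Proof.
move=> hV; rewrite (_ : Ft m = fun w => F (z m w) + xi m w); last first.
  exact/funext/hFt.
have pm := past_measurable hxi m.+1.
apply: square_integrable_vectorD => //; last exact: noise_square_integrable.
apply: (square_integrable_vector_op pm hL hLip).
exact: square_integrable_vector_past_succ.
Qed.

(** The iterate [z m] is built from the oracle outputs before [m]. The induction runs over integer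
    indices, and each half step is derived from the integer iterate preceding it. *)
Lemma square_integrable_iterates (k : nat) :
  square_integrable_vector P (past xi k.*2) (z k.*2) /\
  square_integrable_vector P (past xi k.*2.+1) (z k.*2.+1).
Proof.
have half j : square_integrable_vector P (past xi j.*2) (z j.*2) ->
    square_integrable_vector P (past xi j.*2.+1) (z j.*2.+1).
  move=> hj; rewrite (_ : z j.*2.+1 = fun w => z j.*2 w + (1 / j.+1%:R) *:
    (z0 - z j.*2 w) - ((1 - 1 / j.+1%:R) * (1 / L)) *: Ft j.*2 w); last first.
    by apply/funext => w; have [] := hz.2 j w.
  apply: square_integrable_prediction; last exact: square_integrable_oracle.
  exact: square_integrable_vector_past_succ.
elim: k => [|k [IH1 IH2]]; split; try apply: half.
- rewrite (_ : z 0.*2 = fun=> z0); last exact/funext/hz.1.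
  exact: square_integrable_vector_cst.
- rewrite (_ : z 0.*2 = fun=> z0); last exact/funext/hz.1.
  exact: square_integrable_vector_cst.
all: rewrite (_ : z k.+1.*2 = fun w => z k.*2 w + (1 / k.+1%:R) *:
    (z0 - z k.*2 w) - (1 / L) *: Ft k.*2.+1 w);
  [|by apply/funext => w; have [] := hz.2 k w].
all: rewrite doubleS; apply: square_integrable_prediction;
  [|exact: square_integrable_oracle].
(* The full step restarts from [z k.*2], two indices earlier, so the past is enlarged twice. *)
all: by do 2! apply: square_integrable_vector_past_succ.
Qed.

Lemma integrable_potential (k : nat) :
  P.-integrable setT (EFin \o (fun w => potential L F z0 k (z k.*2 w))).
Proof.
have [hk _] := square_integrable_iterates k.
have pm := past_measurable hxi k.*2.
have hF := square_integrable_vector_op pm hL hLip hk.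
have i1 := integrable_scale (k%:R ^+ 2)
  (square_integrable_vector_dotv pm hF hF).
have h0 := square_integrable_vectorB pm
  (square_integrable_vector_cst (P := P) (G := past xi k.*2) z0) hk.
have i2 := integrable_scale (- (2 * L * k%:R))
  (square_integrable_vector_dotv pm hF h0).
have := integrable_add i1 i2; apply: eq_integrable => // w _ /=.
by rewrite /potential mulNr.
Qed.

(* The noise-free points [zb] and [zb'] are independent of the noise that the
   method adds there, so the cross terms of the pathwise estimate vanish. *)
Lemma expectation_potential_step (k : nat) :
  \int[P]_w potential L F z0 k.+1 (z k.+1.*2 w) <=
  \int[P]_w potential L F z0 k (z k.*2 w) +
  3 * (k.+1%:R ^+ 2 * sigma k.*2.+1 ^+ 2 + k%:R ^+ 2 * sigma k.*2 ^+ 2).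
Proof.
have [hk hk1] := square_integrable_iterates k.
have pm := past_measurable hxi k.*2; have pm1 := past_measurable hxi k.*2.+1.
have hF := square_integrable_vector_op pm hL hLip hk.
have hF1 := square_integrable_vector_op pm1 hL hLip hk1.
pose zb w := z k.*2 w + (1 / k.+1%:R) *: (z0 - z k.*2 w)
              - ((1 - 1 / k.+1%:R) * (1 / L)) *: F (z k.*2 w).
pose zb' w := z k.*2 w + (1 / k.+1%:R) *: (z0 - z k.*2 w)
              - (1 / L) *: F (z k.*2.+1 w).
have hFb := square_integrable_vector_op pm hL hLip
  (square_integrable_prediction _ _ hk hF : square_integrable_vector P _ zb).
have hFb' := square_integrable_vector_op pm1 hL hLip
  (square_integrable_prediction _ _ (square_integrable_vector_past_succ hk) hF1
   : square_integrable_vector P _ zb').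
have hxk := noise_square_integrable k.*2.
(* [W] may involve [xi k.*2], since it is paired with the later [xi k.*2.+1]; [V] is paired with
   [xi k.*2] and must avoid it. *)
pose W w := (2 * k.+1%:R ^+ 2) *: (F (z k.*2.+1 w) - F (zb' w))
            - (2 * k.+1%:R * k%:R) *: xi k.*2 w.
pose V w := (2 * k%:R ^+ 2) *: F (z k.*2 w) - (2 * k.+1%:R * k%:R) *: F (zb w).
have hW : square_integrable_vector P (past xi k.*2.+1) W.
  apply: square_integrable_vectorB => //; apply: square_integrable_vectorZ => //.
  exact: square_integrable_vectorB.
have hV : square_integrable_vector P (past xi k.*2) V.
  by apply: square_integrable_vectorB => //; exact: square_integrable_vectorZ.
have iW := integrable_dotv_noise hxi noise_fin hW.
have iV := integrable_dotv_noise hxi noise_fin hV.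
have iN m := square_integrable_vector_dotv (past_measurable hxi m.+1)
  (noise_square_integrable m) (noise_square_integrable m).
have iNN := integrable_scale 3 (integrable_add
  (integrable_scale (k.+1%:R ^+ 2) (iN k.*2.+1))
  (integrable_scale (k%:R ^+ 2) (iN k.*2))).
have iP := integrable_potential k.
have iPN := integrable_add iP iNN.
have iC := integrable_add iW iV.
apply: le_trans (_ : \int[P]_w (potential L F z0 k (z k.*2 w)
    + 3 * (k.+1%:R ^+ 2 * dotv (xi k.*2.+1 w) (xi k.*2.+1 w)
           + k%:R ^+ 2 * dotv (xi k.*2 w) (xi k.*2 w))
    + (dotv (W w) (xi k.*2.+1 w) + dotv (V w) (xi k.*2 w))) <= _).
  apply: le_Rintegral => //.
  - exact: integrable_potential.
  - exact: integrable_add iPN iC.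
  move=> w _; have [zh z1] := hz.2 k w.
  apply: potential_step => //.
    by rewrite zh hFt [_ *: (F _ + _)]scalerDr opprD addrA.
  by rewrite z1 hFt [_ *: (F _ + _)]scalerDr opprD addrA.
rewrite (RintegralD measurableT iPN iC) (RintegralD measurableT iW iV).
rewrite (expectation_dotv_noise hxi hind hmean noise_fin hW).
rewrite (expectation_dotv_noise hxi hind hmean noise_fin hV) !addr0.
rewrite (RintegralD measurableT iP iNN) lerD2l.
have i1 := integrable_scale (k.+1%:R ^+ 2) (iN k.*2.+1).
have i2 := integrable_scale (k%:R ^+ 2) (iN k.*2).
rewrite (RintegralZl _ measurableT (integrable_add i1 i2)).
rewrite (RintegralD measurableT i1 i2).
rewrite (RintegralZl _ measurableT (iN k.*2.+1)).
by rewrite (RintegralZl _ measurableT (iN k.*2)) !expectation_noise_sqr.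
Qed.

(** The one-step bounds telescope from a potential that vanishes at index 0. The term [l = 0]
    contributes only the variance at index 1/2. *)
Lemma expectation_potential_le (k : nat) :
  \int[P]_w potential L F z0 k (z k.*2 w) <=
  3 * \sum_(0 <= l < k)
    (l%:R ^+ 2 * sigma l.*2 ^+ 2 + l.+1%:R ^+ 2 * sigma l.*2.+1 ^+ 2).
Proof.
elim: k => [|k IH].
  rewrite big_geq// mulr0 (_ : (fun _ => _) = fun=> 0).
    by rewrite Rintegral_cst// mul0r.
  by apply/funext => w; exact: potential0.
rewrite big_nat_recr//= mulrDr (le_trans (expectation_potential_step k))//.
by rewrite [X in 3 * X]addrC lerD2r.
Qed.

(** The constant 6 is the factor 2 in front of the potential in [sqr_le_potential] times the 3 of
    the noise squares. *)
Lemma expectation_operator_le (zs : 'rV[R]_n) (k : nat) : F zs = 0 ->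
  (1 <= k)%N ->
  ('E_P[fun w => (enorm (F (z k.*2 w)) ^+ 2)%R] <=
    (4 * L ^+ 2 * enorm (z0 - zs) ^+ 2 / k%:R ^+ 2 + 6 / k%:R ^+ 2 *
     \sum_(0 <= l < k)
       (l%:R ^+ 2 * sigma l.*2 ^+ 2 + l.+1%:R ^+ 2 * sigma l.*2.+1 ^+ 2))%:E)%E.
Proof.
move=> Fzs k1; have k0 : 0 < k%:R ^+ 2 :> R by rewrite exprn_gt0// ltr0n.
have [hk _] := square_integrable_iterates k.
have pm := past_measurable hxi k.*2.
have hF := square_integrable_vector_op pm hL hLip hk.
have iF := square_integrable_vector_dotv pm hF hF.
rewrite unlock.
rewrite (_ : (\int[P]_w _)%E =
  (\int[P]_w dotv (F (z k.*2 w)) (F (z k.*2 w)))%:E); last first.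
  rewrite /Rintegral fineK; last exact: integrable_fin_num iF.
  by apply: eq_integral => w _; rewrite enorm_sqr.
rewrite lee_fin enorm_sqr.
have iP := integrable_potential k.
pose c := 4 * L ^+ 2 * dotv (z0 - zs) (z0 - zs).
have ic : P.-integrable setT (EFin \o (fun=> c)).
  exact: finite_measure_integrable_cst.
have h : k%:R ^+ 2 * \int[P]_w dotv (F (z k.*2 w)) (F (z k.*2 w)) <=
    2 * \int[P]_w potential L F z0 k (z k.*2 w) + c.
  have cE : \int[P]_w c = c.
    rewrite Rintegral_cst// [X in fine X](_ : _ = 1%E) ?mulr1//.
    exact: probability_setT.
  rewrite -(RintegralZl _ measurableT iF) -(RintegralZl _ measurableT iP).
  rewrite -[X in _ + X]cE.
  move: (RintegralD measurableT (integrable_scale 2 iP) ic) => /= <-.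
  apply: le_Rintegral => //.
  - exact: integrable_scale iF.
  - exact: integrable_add (integrable_scale 2 iP) ic.
  by move=> w _; exact: sqr_le_potential.
have := expectation_potential_le k; move: (\sum_(0 <= l < k) _) => s hs.
rewrite -/c [6 / _ * s]mulrAC -mulrDl ler_pdivlMr// mulrC (le_trans h)//.
by move: hs; lra.
Qed.
End sfeg_iterates.

(** The weights turn the assumed variances into at most [eps / 6 * l] and [eps / 6 * (l + 1)], and
    [1] plus the sum of the odd numbers [2 l + 1] for [l] from 1 to [k - 1] is [k^2]. *)
Lemma noise_budget_le {R : realType} {sigma : nat -> R} {eps : R} :
  sigma 0%N ^+ 2 <= eps / 6 ->
  (forall k : nat, (1 <= k)%N -> sigma k.*2 ^+ 2 <= eps / (6 * k%:R)) ->
  (forall k : nat, (1 <= k)%N ->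
    sigma k.*2.+1 ^+ 2 <= eps / (6 * k.+1%:R)) ->
  forall k : nat, (1 <= k)%N ->
  sigma 0%N ^+ 2 + \sum_(1 <= l < k) (l%:R ^+ 2 * sigma l.*2 ^+ 2 +
                               l.+1%:R ^+ 2 * sigma l.*2.+1 ^+ 2)
    <= eps / 6 * k%:R ^+ 2.
Proof.
move=> h0 h1 h2; elim=> [//|[_ _|k IH _]].
  by rewrite big_geq// addr0 expr1n mulr1.
rewrite big_nat_recr//= addrA.
have k0 : 0 < k.+1%:R :> R by [].
have k0' : 0 < k.+2%:R :> R by [].
have a1 := ler_wpM2l (ltW (exprn_gt0 2 k0)) (h1 k.+1 isT).
have a2 := ler_wpM2l (ltW (exprn_gt0 2 k0')) (h2 k.+1 isT).
have e1 : k.+1%:R ^+ 2 * (eps / (6 * k.+1%:R)) = eps / 6 * k.+1%:R.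
  by field; exact: lt0r_neq0.
have e2 : k.+2%:R ^+ 2 * (eps / (6 * k.+2%:R)) = eps / 6 * k.+2%:R.
  by field; exact: lt0r_neq0.
rewrite e1 in a1; rewrite e2 in a2.
apply: le_trans (lerD (IH isT) (lerD a1 a2)) _.
by rewrite -[k.+2%:R]natr1; move: (k.+1%:R : R) => x; lra.
Qed.

(* hsigma_half: at k = 0 the method gives z_{1/2} = z_0, so the oracle is queried
   at the same point and its noise level there, sigma_{1/2}, is the one that the
   bound writes sigma_0; only sigma_{1/2}^2 <= sigma_0^2 is asked for. Without
   it the bound fails: f x = L x^2 / 2 on R (so F z = L z), z_0 = z_* = 0,
   sigma_0 = 0 and sigma_{1/2} = 1 give F z_1 = - xi_{1/2}. *)
Theorem theorem6p1 (disp : measure_display) (T : measurableType disp)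
    (R : realType) (P : probability T R) (dx dy : nat)
    (f : 'rV[R]_dx -> 'rV[R]_dy -> R) (hf : smooth f)
    (F : 'rV[R]_(dx + dy) -> 'rV[R]_(dx + dy))
    (hF : forall z, F z = saddle_gradient f z)
    (L : R) (hL : 0 < L) (hLip : lipschitz_op L F) (hmon : monotone_op F)
    (xi : nat -> T -> 'rV[R]_(dx + dy)) (sigma : nat -> R)
    (hxi : forall n, random_vector (xi n))
    (hind : independent_vectors P xi)
    (hmean : forall n i, ('E_P[fun w => (xi n w 0 i)%R] = 0)%E)
    (hvar : forall n,
      ('E_P[fun w => (enorm (xi n w) ^+ 2)%R] = (sigma n ^+ 2)%R%:E)%E)
    (hsigma_half : sigma 1%N ^+ 2 <= sigma 0%N ^+ 2)
    (z0 : 'rV[R]_(dx + dy)) (z Ft : nat -> T -> 'rV[R]_(dx + dy))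
    (hFt : forall n w, Ft n w = F (z n w) + xi n w)
    (hz : sfeg L z0 Ft z) :
  (forall zs : 'rV[R]_(dx + dy), F zs = 0 ->
    forall k : nat, (1 <= k)%N ->
      ('E_P[fun w => (enorm (F (z k.*2 w)) ^+ 2)%R] <=
        (4 * L ^+ 2 * enorm (z0 - zs) ^+ 2 / k%:R ^+ 2 +
         6 / k%:R ^+ 2 *
           (sigma 0%N ^+ 2 +
            \sum_(1 <= l < k) (l%:R ^+ 2 * sigma l.*2 ^+ 2 +
                               l.+1%:R ^+ 2 * sigma l.*2.+1 ^+ 2)))%R%:E)%E) /\
  (forall eps : R,
    sigma 0%N ^+ 2 <= eps / 6 ->
    (forall k : nat, (1 <= k)%N -> sigma k.*2 ^+ 2 <= eps / (6 * k%:R)) ->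
    (forall k : nat, (1 <= k)%N ->
      sigma k.*2.+1 ^+ 2 <= eps / (6 * k.+1%:R)) ->
    forall zs : 'rV[R]_(dx + dy), F zs = 0 ->
    forall k : nat, (1 <= k)%N ->
      ('E_P[fun w => (enorm (F (z k.*2 w)) ^+ 2)%R] <=
        (4 * L ^+ 2 * enorm (z0 - zs) ^+ 2 / k%:R ^+ 2 + eps)%R%:E)%E).
Proof.
have bound zs (Fzs : F zs = 0) k : (1 <= k)%N ->
  ('E_P[fun w => (enorm (F (z k.*2 w)) ^+ 2)%R] <=
    (4 * L ^+ 2 * enorm (z0 - zs) ^+ 2 / k%:R ^+ 2 +
     6 / k%:R ^+ 2 *
       (sigma 0%N ^+ 2 +
        \sum_(1 <= l < k) (l%:R ^+ 2 * sigma l.*2 ^+ 2 +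
                           l.+1%:R ^+ 2 * sigma l.*2.+1 ^+ 2)))%R%:E)%E.
  move=> k1.
  apply: le_trans (expectation_operator_le hL hLip hmon hxi hind hmean hvar
    hFt hz _ _ Fzs k1) _.
  rewrite lee_fin lerD2l; apply: ler_wpM2l; first by rewrite divr_ge0// sqr_ge0.
  (* In the term [l = 0] the variance at index 0 has weight 0, so only [sigma 1 ^+ 2] remains to be
     compared with [sigma 0 ^+ 2]. *)
  rewrite big_ltn// expr0n mul0r add0r lerD2r expr1n mul1r.
  exact: hsigma_half.
split => // eps h0 h1 h2 zs Fzs k k1.
apply: le_trans (bound zs Fzs k k1) _; rewrite lee_fin lerD2l.
have k0 : 0 < k%:R ^+ 2 :> R by rewrite exprn_gt0// ltr0n.
rewrite mulrAC ler_pdivrMr//.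
by have := noise_budget_le h0 h1 h2 k k1; lra.
Qed.
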